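(* Let $G=(V,E)$ be a finite connected simple graph with $|E|\ge 2$. For $\delta>0$ and $n\ge1$ let $$\overline{M}_n(\delta)=\max\{p_G(\mathbf{n}):\ \mathbf{n}\in\mathbb{Z}_{\ge0}^E,\ \mathbf{n}/n\in\mathcal{S}_G,\ \mathrm{dist}(\mathbf{n}/n,\partial\mathcal{R}_G)\le\delta\}.$$ Then for any $\delta>0$ we have $\limsup_{n\to\infty}\overline{M}_n(\delta)\le c_G$.
   Context: Let $k=|V|$. For $F\subset E$ let $\deg_F(v)$ be the number of edges of $F$ incident with $v$, $\deg_G(v)=\deg_E(v)$, and $d(F)=|\{v\in V:\deg_F(v)=\deg_G(v)\}|$. Let $\mathcal{S}_G=\{\mathbf{x}\in\mathbb{R}^E: x_e\ge0,\ \sum_{e\in E}x_e=1\}$ and $$\mathcal{R}_G=\{\mathbf{x}\in\mathcal{S}_G:\ \sum_{e\in F}x_e>\tfrac1k d(F)\ \text{for all } \emptyset\subsetneq F\subsetneq E\}.$$ $\partial\mathcal{R}_G$ is the boundary of $\mathcal{R}_G$ relative to the hyperplane $\{\mathbf{x}\in\mathbb{R}^E:\sum_{e\in E} x_e=1\}$, and $\mathrm{dist}$ is Euclidean distance in $\mathbb{R}^E$. The game: start from $\mathbf{N}(0)=\mathbf{n}=(n_e:e\in E)\in\mathbb{Z}_{\ge0}^E$, with $n=\sum_{e\in E} n_e$. In each round $t=1,\dots,n$ an independent uniformly random vertex $V_t\in V$ is drawn, the player sees it and must choose an edge $e$ incident with $V_t$, and then $\mathbf{N}(t)=\mathbf{N}(t-1)-\mathbf{1}^e$,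 where $\mathbf{1}^e$ is the unit coordinate vector of $e$. The player wins if $\mathbf{N}(n)=(0,\dots,0)$. $p_G(\mathbf{n})$ is the probability of winning under the optimal strategy. Equivalently, $p_G(\mathbf{0})=1$, $p_G(\mathbf{n})=0$ if some coordinate of $\mathbf{n}$ is negative, and for other $\mathbf{n}$, $p_G(\mathbf{n})=\frac1k\sum_{v\in V}\max_{e\in E:\,e\sim v}p_G(\mathbf{n}-\mathbf{1}^e)$, where $e\sim v$ means $e$ is incident with $v$. $c_G>0$ denotes the constant, depending only on $G$, such that $p_G(\mathbf{n}^{(n)})\to c_G$ as $n\to\infty$ whenever $\mathbf{x}\in\mathcal{R}_G$, $\mathbf{n}^{(n)}\in\mathbb{Z}_{\ge0}^E$, $\sum_{e\in E} n^{(n)}_e=n$ and $\mathbf{n}^{(n)}=n\mathbf{x}+O(1)$ (such a constant exists and is unique). *)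

(* Defs.v *)
From HB Require Import structures.
From mathcomp Require Import all_boot all_order all_algebra.
From mathcomp Require Import all_classical all_reals all_analysis.

Set Implicit Arguments.
Unset Strict Implicit.
Unset Printing Implicit Defensive.
Import Order.TTheory GRing.Theory Num.Theory.
Import numFieldNormedType.Exports.
Local Open Scope ring_scope.

Record simple_graph := SimpleGraph {
  vertex :> finType;
  adj : rel vertex;
  adj_sym : symmetric adj;
  adj_irr : irreflexive adj }.

Section Graph.
Context (G : simple_graph).
Implicit Types (v : G).

Definition connected_graph : Prop := forall u v, connect (@adj G) u v.

Definition is_edge (A : {set G}) : bool :=
  [exists u, [exists v, adj u v && (A == [set u; v])]].

Definition edge : finType := {A : {set G} | is_edge A}.

Definition incident v (e : edge) : bool := v \in sval e.

Definition deg (F : {set edge}) v : nat := #|[set e in F | incident v e]|.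

Definition full_deg_count (F : {set edge}) : nat :=
  #|[set v | deg F v == deg [set: edge] v]|.

End Graph.

Local Open Scope classical_set_scope.

Section Region.
Context (R : realType) (G : simple_graph).
Local Notation E := (edge G).
Local Notation RE := {ptws E -> R}.
Local Notation k := (#|G|%:R : R).

Definition sum1_hyperplane : set RE := [set x | \sum_(e : E) x e = 1].

Definition simplex : set RE :=
  [set x | (forall e, 0 <= x e) /\ \sum_(e : E) x e = 1].

Definition region : set RE :=
  [set x | simplex x /\
    forall F : {set E}, finset.set0 \proper F -> F \proper finset.setT ->
      k^-1 * (full_deg_count F)%:R < \sum_(e in F) x e].

(* Closure and interior are those of the subspace topology of the hyperplane
   inside the product topology. In [subspace A] points outside of [A] are
   isolated, hence they never belong to the boundary of a subset of [A]. *)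
Definition region_boundary : set RE :=
  let B : set (subspace sum1_hyperplane) := region in closure B `\` B°.

Definition eucl_dist (x y : RE) : R :=
  Num.sqrt (\sum_(e : E) (x e - y e) ^+ 2).

Definition dist_to (x : RE) (A : set RE) : R :=
  inf [set eucl_dist x y | y in A].

End Region.

Section Game.
Context (G : simple_graph).
Local Notation E := (edge G).

(* The argument is the sequence of vertices drawn so far, the last item being
   the vertex of the current round; the value is the edge played. *)
Definition strategy := seq G -> E.

Definition legal (s : strategy) : Prop :=
  forall (h : seq G) (v : G), incident v (s (rcons h v)).

Definition unit_coord (e : E) : {ffun E -> int} := [ffun f => (f == e)%:Z].

Fixpoint position (s : strategy) (N0 : {ffun E -> int}) (w : seq G) (t : nat) :
    {ffun E -> int} :=
  if t is t'.+1 then position s N0 w t' - unit_coord (s (take t w)) else N0.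

Definition rounds (n : {ffun E -> nat}) : nat := (\sum_(e : E) n e)%N.

Definition wins (s : strategy) (n : {ffun E -> nat})
    (w : (rounds n).-tuple G) : bool :=
  position s [ffun e => (n e)%:Z] w (rounds n) == 0.

(* Independent uniform draws: the uniform distribution on the sequences of
   [rounds n] vertices. *)
Definition win_prob (R : realType) (s : strategy) (n : {ffun E -> nat}) : R :=
  #|[set w : (rounds n).-tuple G | wins s w]%SET|%:R / #|G|%:R ^+ rounds n.

Definition pG (R : realType) (n : {ffun E -> nat}) : R :=
  sup [set win_prob R s n | s in legal].

End Game.

Section Limits.
Context (R : realType) (G : simple_graph).
Local Notation E := (edge G).

(* This determines [c], since [region] is nonempty when [G] is connected with at
   least two edges. *)
Definition is_cG (c : R) : Prop :=
  0 < c /\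
  forall (x : {ptws E -> R}) (N : nat -> {ffun E -> nat}),
    region x ->
    (forall n, rounds (N n) = n) ->
    (exists C : R, forall n e, `|(N n e)%:R - n%:R * x e| <= C) ->
    (fun n => pG R (N n)) @ \oo --> c.

Definition scaled (n : nat) (m : {ffun E -> nat}) : {ptws E -> R} :=
  fun e => (m e)%:R / n%:R.

(* A maximum over finitely many points, with value [-oo] if there are none
   (which happens only for small [n]). *)
Definition Mbar (delta : R) (n : nat) : \bar R :=
  ereal_sup [set (pG R m)%:E | m in
    [set m : {ffun E -> nat} | simplex (scaled n m) /\
      dist_to (scaled n m) (@region_boundary R G) <= delta]].

End Limits.

(* Main.v *)
Require Import Defs.
From mathcomp Require Import all_boot all_order all_algebra.
From mathcomp Require Import all_classical all_reals all_analysis.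
From mathcomp Require Import zify ring lra.

Set Implicit Arguments.
Unset Strict Implicit.
Unset Printing Implicit Defensive.
Import Order.TTheory GRing.Theory Num.Theory.
Import numFieldNormedType.Exports.
Local Open Scope ring_scope.

(** Let [top n] be the supremum of the values of all positions with [n] rounds
    to play.  It bounds the maximum in the statement.  A value is an average of
    values with one round less, so [top] decreases to a limit [M], and it is
    enough to show [M <= c].

    The first half of the proof finds a ball, of any prescribed radius [L], of
    positions with values close to [M] ([near_optimal_ball]).  Take a position
    whose value is close to [M], with many rounds to play.  As no value is much
    above [M], every position in its tree of optimal play is again close to [M]
    down to any fixed depth, whatever is drawn ([run_gap]).  Colour a position
    of the tree by the map sending a vertex to the edge optimally played there.
    There are finitely many colours, so from some node on one colour [f] recurs
    below every node within bounded time ([dense_colour]).  A second player,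
    displaced by [u e - u (f v)] for some edge [e] at [v], can follow the optimal
    play from there: copy every move, until at a node of colour [f] the vertex
    [v] is drawn, then play [e] instead of [f v].  This
    happens almost surely if one waits long enough, and then both positions
    coincide.  Sums of boundedly many such displacements can be corrected one
    after the other ([follower]).  As the graph is connected, these sums
    contain a ball of radius [L] around some [D0] ([reachable_ball]).

    The second half starts far away from this ball.  Let [y] be the frequencies
    with which edges are chosen if each draw is answered by a uniformly random
    incident edge.  By connectedness [y] satisfies all the strict inequalities
    that define the region ([flow_direction_region]), so the values of the
    positions [N0 + t y] tend to [c] for every fixed [N0].  On the other hand,
    let a player start at [N0 + t y] and always choose the edge with the largest
    surplus over a target that moves along [- y].  The quadratic energy of the
    surplus then has a negative drift proportional to the size of the surplus.  Thus at suitable times the player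
    ends within distance [L] of [N0] with probability close to [1], where [L]
    depends neither on [t] nor on [N0] ([steering]).  If [N0] is the centre of
    a ball of positions with values close to [M], the value of [N0 + t y] is
    nearly as large for arbitrarily large [t], and [M <= c] follows. *)

(** * Edges of a connected graph *)

Section Edges.
Context (G : simple_graph).
Implicit Types (v : G) (e : edge G).

Lemma edge_ends e : exists u v, adj u v /\ sval e = [set u; v]%SET.
Proof.
case: e => A /= /existsP[u /existsP[v /andP[uv /eqP ->]]].
by exists u, v.
Qed.

Lemma edge_vertex e : exists v, incident v e.
Proof.
have [u [v [_ euv]]] := edge_ends e.
by exists u; rewrite /incident euv !inE eqxx.
Qed.

Lemma edge_of_adj (u v : G) : adj u v -> exists e, incident u e /\ incident v e.
Proof.
move=> uv; have Euv : is_edge [set u; v]%SET.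
  by apply/existsP; exists u; apply/existsP; exists v; rewrite uv eqxx.
exists (exist (fun A : {set G} => is_edge A) _ Euv); rewrite /incident /= !inE !eqxx orbT.
by split.
Qed.

(** The line graph of a connected graph is connected. *)
Lemma edge_connected_ind (P : edge G -> Prop) e0 :
  connected_graph G -> P e0 ->
  (forall v e e', incident v e -> incident v e' -> P e -> P e') ->
  forall e, P e.
Proof.
move=> Gconn P0 Pstep e.
have [u0 u0e] := edge_vertex e0; have [u ue] := edge_vertex e.
have /connectP[p] := Gconn u0 u.
elim: p u0 e0 P0 u0e => [|w p IH] u0 e0 P0 u0e /=.
  by move=> _ uu0; rewrite uu0 in ue; exact: Pstep u0e ue P0.
move=> /andP[u0w wp] up; have [e1 [u0e1 we1]] := edge_of_adj u0w.
exact: IH e1 (Pstep _ _ _ u0e u0e1 P0) we1 wp up.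
Qed.

Lemma incident_edge v :
  connected_graph G -> (0 < #|edge G|)%N -> exists e, incident v e.
Proof.
move=> Gconn /card_gt0P[e0 _].
have [u u0] := edge_vertex e0.
have /connectP[p] := Gconn v u.
case: p => [_ /= uv|w p /= /andP[vw _] _]; first by exists e0; rewrite -uv.
by have [e [ve _]] := edge_of_adj vw; exists e.
Qed.

End Edges.

(** * The value function *)

Section Value.
Context (R : realType) (G : simple_graph).
Context (d : G -> edge G) (dP : forall v, incident v (d v)).
Local Notation E := (edge G).
Local Notation pos := {ffun E -> int}.
Local Notation u := (@unit_coord G).
Implicit Types (N D : pos) (v : G) (e : E).

(** The edge [d v] is the witness of nonemptiness that a maximum over the edges
    at [v] requires. *)
Definition best disp (T : orderType disp) (f : E -> T) v : E :=
  [arg max_(e > d v | incident v e) f e]%O.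

Lemma best_incident disp (T : orderType disp) (f : E -> T) v :
  incident v (best f v).
Proof. by rewrite /best; case: (arg_maxP f (dP v)). Qed.

Lemma best_max disp (T : orderType disp) (f : E -> T) v e :
  incident v e -> (f e <= f (best f v))%O.
Proof. by move=> ve; rewrite /best; case: (arg_maxP f (dP v)) => e' _; apply. Qed.

Definition avg (f : G -> R) : R := #|G|%:R^-1 * \sum_v f v.

(** Positions may have negative coordinates and any sum: plays only lower
    coordinates, so such positions get value [0] from the boundary case. *)
Fixpoint val t N : R :=
  if t is t'.+1 then avg (fun v => val t' (N - u (best (fun e => val t' (N - u e)) v)))
  else (N == 0)%:R.

Definition play t N v : E := best (fun e => val t (N - u e)) v.

Lemma play_incident t N v : incident v (play t N v).
Proof. exact: best_incident. Qed.

Lemma valS t N : val t.+1 N = avg (fun v => val t (N - u (play t N v))).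
Proof. by []. Qed.

Lemma play_max t N v e : incident v e -> val t (N - u e) <= val t (N - u (play t N v)).
Proof. by move=> ve; exact: (best_max (fun e => val t (N - u e)) ve). Qed.

Lemma le_avg f g : (forall v, f v <= g v) -> avg f <= avg g.
Proof.
by move=> fg; rewrite /avg ler_wpM2l ?invr_ge0 ?ler0n// ler_sum.
Qed.

Lemma avg_const a : (0 < #|G|)%N -> avg (fun=> a) = a.
Proof.
move=> k0; rewrite /avg sumr_const -[a *+ _]mulr_natl mulKf// pnatr_eq0.
by rewrite -lt0n.
Qed.

Lemma avgZ a f : avg (fun v => a * f v) = a * avg f.
Proof. by rewrite /avg -mulr_sumr mulrCA. Qed.

Lemma avgD f g : avg (fun v => f v + g v) = avg f + avg g.
Proof. by rewrite /avg big_split mulrDr. Qed.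

Lemma val_ge_choice t N (pi : G -> E) : (forall v, incident v (pi v)) ->
  avg (fun v => val t (N - u (pi v))) <= val t.+1 N.
Proof. by move=> piP; rewrite valS; apply: le_avg => v; exact: play_max. Qed.

Lemma val_ge0 t N : 0 <= val t N.
Proof.
elim: t N => [|t IH] N; first exact: ler0n.
by rewrite valS /avg mulr_ge0 ?invr_ge0 ?ler0n// sumr_ge0.
Qed.

Context (k_gt0 : (0 < #|G|)%N).

Lemma val_le1 t N : val t N <= 1.
Proof.
elim: t N => [|t IH] N; first by rewrite /= lern1 leq_b1.
by rewrite valS -[leRHS](avg_const 1 k_gt0); apply: le_avg.
Qed.

Lemma val_gt0_ge0 t N e : 0 < val t N -> 0 <= N e.
Proof.
elim: t N => [|t IH] N.
  by rewrite /=; case: eqP => [->|_]; rewrite ?ffunE ?ltxx.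
rewrite valS /avg pmulr_rgt0 ?invr_gt0 ?ltr0n// => s0.
have /existsP[v v0] : [exists v, 0 < val t (N - u (play t N v))].
  apply: contraTT s0 => /existsPn s0; rewrite -leNgt sumr_le0// => v _.
  by rewrite leNgt s0.
by have := IH _ v0; rewrite !ffunE; case: eqP => _ /=; lia.
Qed.

Lemma unit_coordE e f : u e f = (f == e)%:Z.
Proof. by rewrite ffunE. Qed.

Lemma sum_unit_coord e : \sum_f u e f = 1.
Proof.
rewrite (bigD1 e)//= ffunE eqxx big1 ?addr0// => f /negPf fe.
by rewrite ffunE fe.
Qed.

Lemma val_gt0_sum t N : 0 < val t N -> \sum_e N e = t%:Z.
Proof.
elim: t N => [|t IH] N.
  rewrite /=; case: eqP => [->|_]; rewrite ?ltxx// => _.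
  by rewrite big1// => e _; rewrite ffunE.
rewrite valS /avg pmulr_rgt0 ?invr_gt0 ?ltr0n// => s0.
have /existsP[v v0] : [exists v, 0 < val t (N - u (play t N v))].
  apply: contraTT s0 => /existsPn s0; rewrite -leNgt sumr_le0// => v _.
  by rewrite leNgt s0.
have := IH _ v0.
have -> : \sum_e (N - u (play t N v)) e = \sum_e N e - 1.
  rewrite -(sum_unit_coord (play t N v)) -sumrB; apply: eq_bigr => e _.
  by rewrite !ffunE.
by lia.
Qed.

End Value.

(** * Optimal play attains the value *)

Lemma big_tupleS (R : nmodType) (T : finType) t (F : t.+1.-tuple T -> R) :
  \sum_w F w = \sum_v \sum_(w : t.-tuple T) F (cons_tuple v w).
Proof.
rewrite pair_bigA /= (reindex (fun p : T * t.-tuple T => cons_tuple p.1 p.2))//.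
exists (fun w => (thead w, behead_tuple w)) => [[v w] _|w _] /=.
  by rewrite theadE; congr pair; apply: val_inj.
by apply: val_inj => /=; rewrite [in RHS](tuple_eta w).
Qed.

Section Strategies.
Context (R : realType) (G : simple_graph).
Context (d : G -> edge G) (dP : forall v, incident v (d v)).
Context (k_gt0 : (0 < #|G|)%N).
Local Notation E := (edge G).
Local Notation pos := {ffun E -> int}.
Local Notation u := (@unit_coord G).
Local Notation val := (@val R G d).
Local Notation play := (@play R G d).
Implicit Types (s : strategy G) (N : pos) (v : G).

Lemma position_cons s N v (w : seq G) t :
  position s N (v :: w) t.+1 =
  position (fun h => s (v :: h)) (N - u (s [:: v])) w t.
Proof.
elim: t => [|t IH]; first by rewrite /= take0.
by rewrite [LHS]/= -/(position s N (v :: w) t.+1) IH.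
Qed.

Definition success_prob s N t : R :=
  (\sum_(w : t.-tuple G) (position s N w t == 0)%:R) / #|G|%:R ^+ t.

Lemma success_probS s N t : success_prob s N t.+1 =
  avg (fun v => success_prob (fun h => s (v :: h)) (N - u (s [:: v])) t).
Proof.
rewrite /success_prob /avg big_tupleS exprS invfM mulrCA mulr_suml.
congr (_ * _); apply: eq_bigr => v _; congr (_ / _).
by apply: eq_bigr => w _; rewrite -position_cons.
Qed.

Lemma win_prob_success s (n : {ffun E -> nat}) :
  win_prob R s n = success_prob s [ffun e => (n e)%:Z] (rounds n).
Proof.
rewrite /win_prob /success_prob; congr (_ / _).
rewrite -sum1_card natr_sum big_mkcond /=; apply: eq_bigr => w _.
by rewrite inE /wins; case: (_ == 0).
Qed.

Lemma success_prob_le_val s N t : legal s -> success_prob s N t <= val t N.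
Proof.
elim: t s N => [|t IH] s N sP.
  rewrite /success_prob expr0 divr1 (eq_bigr (fun=> (N == 0)%:R))//.
  by rewrite sumr_const card_tuple expn0.
rewrite success_probS; apply: le_trans (val_ge_choice R dP t N (pi := fun v => s [:: v]) _).
  by apply: le_avg => v; apply: IH => h w; exact: (sP (v :: h) w).
by move=> v; exact: (sP [::]).
Qed.

(** The empty history never occurs in a game, so the edge at [h = [::]] is
    arbitrary. *)
Fixpoint optimal (e0 : E) t N (h : seq G) : E :=
  if h is v :: h' then
    if h' is [::] then play t.-1 N v
    else optimal e0 t.-1 (N - u (play t.-1 N v)) h'
  else e0.

Lemma optimal_legal e0 t N : legal (optimal e0 t N).
Proof.
move=> h; elim: h t N => [|w h IH] t N v; first exact: play_incident.
have := IH t.-1 (N - u (play t.-1 N w)) v.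
by rewrite rcons_cons /=; case: h {IH}.
Qed.

Lemma optimal_success e0 s t N :
  (forall v h, s (v :: h) = optimal e0 t N (v :: h)) ->
  success_prob s N t = val t N.
Proof.
elim: t s N => [|t IH] s N sE.
  rewrite /success_prob expr0 divr1 (eq_bigr (fun=> (N == 0)%:R))//.
  by rewrite sumr_const card_tuple expn0.
rewrite success_probS valS; congr (_ * _); apply: eq_bigr => v _.
rewrite (sE v [::]) /=.
by apply: IH => w h; rewrite sE.
Qed.

Lemma pG_val (n : {ffun E -> nat}) :
  pG R n = val (rounds n) [ffun e => (n e)%:Z].
Proof.
have /card_gt0P[v0 _] := k_gt0.
pose s := optimal (d v0) (rounds n) [ffun e => (n e)%:Z].
have ub : ubound [set win_prob R s n | s in @legal G]%classic
            (val (rounds n) [ffun e => (n e)%:Z]).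
  by move=> _ [s' s'P <-]; rewrite win_prob_success; exact: success_prob_le_val.
have sA : [set win_prob R s n | s in @legal G]%classic
            (val (rounds n) [ffun e => (n e)%:Z]).
  exists s; first exact: optimal_legal.
  by rewrite win_prob_success; exact: (@optimal_success (d v0)).
apply/eqP; rewrite eq_le; apply/andP; split.
- by apply: ge_sup => //; exists (val (rounds n) [ffun e => (n e)%:Z]).
- by apply: ub_le_sup => //; exists (val (rounds n) [ffun e => (n e)%:Z]).
Qed.

End Strategies.

(** * A dense colour in a tree *)

Section DenseColour.
Context (X V : Type) (C : finType) (step : X -> V -> X) (col : X -> C).
Implicit Types (w : seq V) (x : X) (H : nat -> nat).

Definition dense_below (f : C) (h l : nat) x : Prop :=
  forall w, (size w <= l)%N ->
    exists w', (size w' <= h)%N /\ col (foldl step (foldl step x w) w') = f.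

(** The induction is on the number of colours that may occur below [x]: either
    the colour of [x] is dense, or it is absent below some descendant, where
    one colour fewer remains.  The required depth [H h] may depend on the
    waiting time [h], since [B] is built from the innermost case outwards. *)
Lemma dense_colour H : exists B, forall x, exists w f h,
  [/\ (size w <= B)%N, (h <= B)%N & dense_below f h (H h) (foldl step x w)].
Proof.
suff /(_ #|C|)[B BP] : forall r, exists B, forall (A : {set C}) x,
    (#|A| <= r)%N -> (forall w, (size w <= B)%N -> col (foldl step x w) \in A) ->
    exists w f h, [/\ (size w <= B)%N, (h <= B)%N
      & dense_below f h (H h) (foldl step x w)].
  exists B => x; apply: (BP finset.setT); first by rewrite cardsT.
  by move=> w _; rewrite inE.
elim=> [|r [B IH]].
  exists 0%N => A x; rewrite leqn0 cards_eq0 => /eqP -> /(_ [::] isT).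
  by rewrite inE.
exists (H B + B)%N => A x Ar xA.
have xx : col x \in A by exact: (xA [::]).
have [dn|] := EM (dense_below (col x) B (H B) x).
  by exists [::], (col x), B; split=> //; rewrite leq_addl.
move=> /existsNP[w /not_implyP[wH /forallNP nw]].
have [||w' [f [h [w'B hB df]]]] := IH (A :\ col x)%SET (foldl step x w).
- by rewrite (cardsD1 (col x)) xx in Ar.
- move=> w' w'B; rewrite !inE -foldl_cat xA ?andbT; last first.
    by rewrite size_cat leq_add.
  apply/eqP => e; apply: (nw w'); split=> //.
  by rewrite -foldl_cat.
exists (w ++ w'), f, h; split; last by rewrite foldl_cat.
  by rewrite size_cat leq_add.
by rewrite (leq_trans hB)// leq_addl.
Qed.

End DenseColour.

(** * Following an optimal player from a shifted position *)

Section Follower.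
Context (R : realType) (G : simple_graph).
Context (d : G -> edge G) (dP : forall v, incident v (d v)).
Context (k_gt0 : (0 < #|G|)%N).
Local Notation E := (edge G).
Local Notation pos := {ffun E -> int}.
Local Notation u := (@unit_coord G).
Local Notation val := (@val R G d).
Local Notation play := (@play R G d).
Local Notation kinv := (#|G|%:R^-1 : R).
Implicit Types (N D : pos) (v : G) (e : E) (y : nat * pos) (w : seq G).
Implicit Type f : {ffun G -> E}.

Definition opt_step y v : nat * pos := (y.1.-1, y.2 - u (play y.1.-1 y.2 v)).

Definition opt_map y : {ffun G -> E} := [ffun v => play y.1.-1 y.2 v].

Local Notation run := (foldl opt_step).

(** Displacements that a follower can undo by [r] deviations, if the leader
    answers the relevant draws according to [f]. *)
Fixpoint reachable f (r : nat) D : Prop :=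
  if r is r'.+1 then exists v e D',
    [/\ incident v e, D = D' + (u e - u (f v)) & reachable f r' D']
  else D = 0.

Lemma kinv_gt0 : 0 < kinv.
Proof. by rewrite invr_gt0 ltr0n. Qed.

Lemma kinv_le1 : kinv <= 1.
Proof. by rewrite invf_le1 ?ltr0n// ler1n. Qed.

Lemma avg_bump (F : G -> R) v a g :
  (forall z, a <= F z) -> a + g <= F v -> a + kinv * g <= avg F.
Proof.
move=> aF gF; have <- : avg (fun z => a + (z == v)%:R * g) = a + kinv * g.
  rewrite avgD avg_const//; congr (_ + _ * _).
  by rewrite -mulr_suml (bigD1 v)//= eqxx big1 ?addr0 ?mul1r// => i /negPf ->.
by apply: le_avg => w; case: eqP => [->|_]; rewrite ?mul1r// mul0r addr0.
Qed.

(** One attempt at one deviation.  The follower, displaced by [D], copies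
    the optimal play from [y] until a position of colour [f]; if the next draw
    is [v], playing [e] instead of [f v] brings the displacement to [D'].  On
    every other draw sequence the displacement is still [D]. *)
Lemma follower_attempt f w y D D' v e (a b : R) :
  incident v e -> D = D' + (u e - u (f v)) -> a <= b ->
  (forall w', (size w' <= (size w).+1)%N -> [/\ (0 < (run y w').1)%N,
    a <= val (run y w').1 ((run y w').2 + D) &
    b <= val (run y w').1 ((run y w').2 + D')]) ->
  opt_map (run y w) = f ->
  a + kinv ^+ (size w).+1 * (b - a) <= val y.1 (y.2 + D).
Proof.
move=> ve DD' ab; elim: w y => [|w0 w IH] [t N] yP /= yf.
  have [/= t0 _ _] := yP [::] isT; case: t t0 yP yf => // t _ yP yf.
  pose pi z := if z == v then e else play t N z.
  have piP z : incident z (pi z).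
    by rewrite /pi; case: eqP => [->//|_]; exact: play_incident.
  apply: le_trans (val_ge_choice R dP t (N + D) piP); rewrite expr1.
  have bv : b <= val t (N + D - u (pi v)).
    have [_ _] := yP [:: v] isT; rewrite /= /pi eqxx.
    have -> : play t N v = f v by rewrite -yf ffunE.
    rewrite (_ : N + D - u e = N - u (f v) + D')// DD'.
    by apply/ffunP => i; rewrite !ffunE; ring.
  apply: (@avg_bump _ v) => [z|]; last by rewrite addrC subrK.
  have [->|/negPf zv] := eqVneq z v; first exact: le_trans ab bv.
  have [_ + _] := yP [:: z] isT; rewrite /= /pi zv.
  by rewrite addrAC.
have [/= t0 _ _] := yP [::] isT; case: t t0 yP yf => // t _ yP yf.
have piP z : incident z (play t N z) by exact: play_incident.
apply: le_trans (val_ge_choice R dP t (N + D) piP); rewrite exprS -mulrA.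
apply: (@avg_bump _ w0) => [z|].
  have [_ + _] := yP [:: z] isT; rewrite /=.
  by rewrite addrAC.
rewrite addrAC; apply: (IH (t, N - u (play t N w0))) => // w' w'w.
exact: (yP (w0 :: w')).
Qed.

(** Since a failed attempt costs nothing, sufficiently many attempts bring the
    displacement to [0] with probability close to [1]. *)
Lemma follower h (r : nat) (eta : R) : 0 < eta -> exists H, forall f y D a,
  a <= 1 -> reachable f r D ->
  dense_below opt_step opt_map f h H y ->
  (forall w, (size w <= H)%N -> (0 < (run y w).1)%N /\
     a <= val (run y w).1 (run y w).2) ->
  a - eta <= val y.1 (y.2 + D).
Proof.
elim: r eta => [|r IH] eta eta0.
  exists 0%N => f y D a _ /= -> _ /(_ [::] isT)[_ /= ay].
  by rewrite addr0; apply: le_trans ay; rewrite gerBl ltW.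
have [|H' H'P] := IH (eta / 2); first by rewrite divr_gt0.
pose q := kinv ^+ h.+1.
have q0 : 0 < q by rewrite exprn_gt0// kinv_gt0.
have q1 : q <= 1 by rewrite exprn_ile1// ?kinv_le1// ltW// kinv_gt0.
have [j qj] : exists j, (1 - q) ^+ j <= eta / 2.
  have : ((GRing.exp (1 - q) : nat -> R) @ \oo --> (0 : R))%classic.
    by apply: cvg_expr; rewrite ger0_norm; lra.
  move=> /cvgrPdist_le/(_ (eta / 2)) []; first by rewrite divr_gt0.
  move=> j _ /(_ j (leqnn j)) /=; rewrite sub0r normrN => jP.
  by exists j; apply: le_trans jP; exact: ler_norm.
exists (H' + j * h.+1)%N => f y D a a1 [v [e [D' [ve DD' rD']]]] dy vy.
(* One deviation costs [eta / 2]; the remaining ones, by induction, the rest. *)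
pose b := a - eta / 2.
suff : b - (1 - q) ^+ j <= val y.1 (y.2 + D) by rewrite /b; lra.
elim: j {qj} y dy vy => [|j IHj] y dy vy.
  by apply: le_trans (val_ge0 _ _ _ _); rewrite expr0 /b; lra.
have Hle w : (size w <= h.+1)%N -> (size w <= H' + j.+1 * h.+1)%N.
  by move=> wh; rewrite mulSn; lia.
have [w [wh yf]] := dy [::] isT.
have b0 : 0 <= (1 - q) ^+ j by apply: exprn_ge0; lra.
apply: le_trans (@follower_attempt f w y D D' v e (b - (1 - q) ^+ j) b ve DD' _ _ yf).
- have : q <= kinv ^+ (size w).+1.
    by apply: ler_wiXn2l; rewrite ?kinv_le1// ltW// kinv_gt0.
  rewrite [X in b - X]exprS; move: (kinv ^+ _.+1) ((1 - q) ^+ j) b0 => p X X0 qp.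
  by rewrite subKr; nra.
- by lra.
move=> w' w'w; have {}w'w : (size w' <= h.+1)%N by exact: leq_trans w'w _.
have mono l : (l <= H' + j * h.+1)%N ->
    dense_below opt_step opt_map f h l (run y w') /\
    (forall z, (size z <= l)%N -> (0 < (run (run y w') z).1)%N /\
       a <= val (run (run y w') z).1 (run (run y w') z).2).
  move=> lH; have lw : (size w' + l <= H' + j.+1 * h.+1)%N.
    by rewrite mulSn; lia.
  split=> z zl; last by rewrite -foldl_cat; apply: vy; rewrite size_cat; lia.
  have [|z' [z'h z'P]] := dy (w' ++ z); first by rewrite size_cat; lia.
  by move: z'P; rewrite foldl_cat; exists z'.
have [d1 v1] := mono _ (leqnn _); have [d2 v2] := mono _ (leq_addr (j * h.+1) H').
split; first by have [] := v1 [::] isT.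
- exact: IHj.
- exact: (H'P f (run y w') D' a).
Qed.

End Follower.

(** * Reachable displacements contain large balls *)

Lemma subr_exchange (V : zmodType) (a b x y z c : V) :
  a - b = x - z -> a + (y - c) - (b + (x - c)) = y - z.
Proof.
move=> ab; rewrite opprD addrACA ab opprB [X in _ + X]addrA subrK.
by rewrite addrC addrA subrK.
Qed.

Section Cone.
Context (G : simple_graph) (Gconn : connected_graph G).
Context (E_gt0 : (0 < #|edge G|)%N).
Local Notation E := (edge G).
Local Notation pos := {ffun E -> int}.
Local Notation u := (@unit_coord G).
Implicit Types (D A B : pos) (v : G) (e : E) (f : {ffun G -> E}).

Lemma reachableD f r s A B :
  reachable f r A -> reachable f s B -> reachable f (r + s) (A + B).
Proof.
move=> rA sB; elim: r A rA => [|r IH] A /=; first by move=> ->; rewrite add0r.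
move=> [v [e [A' [ve -> rA']]]]; exists v, e, (A' + B); split=> //.
  by rewrite addrAC.
exact: IH.
Qed.

Lemma reachableMn f r A n : reachable f r A -> reachable f (n * r) (A *+ n).
Proof.
move=> rA; elim: n => [|n IH]; first by rewrite mulr0n.
by rewrite mulSn mulrS; exact: reachableD.
Qed.

Lemma reachable_sum f (r : E -> nat) (A : E -> pos) :
  (forall e, reachable f (r e) (A e)) -> reachable f (\sum_e r e) (\sum_e A e).
Proof.
move=> rA; elim: (index_enum _) => [|e s IH]; first by rewrite !big_nil.
by rewrite !big_cons; exact: reachableD.
Qed.

Lemma reachable1 f v e : incident v e -> reachable f 1 (u e - u (f v)).
Proof. by move=> ve; exists v, e, 0; split=> //; rewrite add0r. Qed.

Lemma reachable_pad f r s A v : incident v (f v) -> (r <= s)%N ->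
  reachable f r A -> reachable f s A.
Proof.
move=> vf /subnK <- rA; elim: (s - r)%N => // n IH.
by exists v, (f v), A; split=> //; rewrite subrr addr0.
Qed.

(** Moving from [e] to an adjacent [e'] through [v] is the difference of the
    two replacements of [f v] by [e'] and by [e]; the line graph is
    connected, so all [u e - u e0] are differences of reachable displacements. *)
Lemma reachable_difference f e0 e : exists r A B,
  [/\ reachable f r A, reachable f r B & A - B = u e - u e0].
Proof.
apply: (edge_connected_ind (e0 := e0)
  (P := fun e => exists r A B,
     [/\ reachable f r A, reachable f r B & A - B = u e - u e0])); first exact: Gconn.
  by exists 0%N, 0, 0; split=> //; rewrite !subrr.
move=> v e1 e2 ve1 ve2 [r [A [B [rA rB AB]]]].
exists (r + 1)%N, (A + (u e2 - u (f v))), (B + (u e1 - u (f v))).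
split; [exact: reachableD rA (reachable1 _ ve2)|
        exact: reachableD rB (reachable1 _ ve1)|].
exact: subr_exchange AB.
Qed.

(** The reachable displacements form a semigroup generating the group of
    displacements of sum zero, hence contain balls of any radius [L]. *)
Lemma reachable_ball f (L : nat) : exists r D0, forall D,
  \sum_e D e = 0 -> (forall e, `|D e| <= L%:Z) -> reachable f r (D0 + D).
Proof.
have /card_gt0P[e0 _] := E_gt0.
have /choice[F FP] : forall e, exists F : nat * pos * pos,
    [/\ reachable f F.1.1 F.1.2, reachable f F.1.1 F.2
      & F.1.2 - F.2 = u e - u e0].
  by move=> e; have [r [A [B ?]]] := reachable_difference f e0 e; exists (r, A, B).
(* The coefficients of [D0 + D] on the two reachable parts of [u e - u e0] are
   [L + D e] and [L - D e]; they are nonnegative and have constant sum. *)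
exists (\sum_e 2 * L * (F e).1.1)%N, (\sum_e ((F e).1.2 + (F e).2) *+ L) => D D0 DL.
rewrite (eq_bigr (fun e => absz (L%:Z + D e)%R * (F e).1.1
                         + absz (L%:Z - D e)%R * (F e).1.1)%N); last first.
  by move=> e _; rewrite -mulnDl; congr (_ * _)%N; have := DL e; lia.
rewrite (_ : _ + D = \sum_e ((F e).1.2 *+ absz (L%:Z + D e)%R
                           + (F e).2 *+ absz (L%:Z - D e)%R)).
  apply: reachable_sum => e; have [rA rB _] := FP e.
  by apply: reachableD; exact: reachableMn.
apply/ffunP => i; rewrite ffunE !sum_ffunE.
have -> : D i = \sum_e D e * ((i == e)%:Z - (i == e0)%:Z).
  under eq_bigr do rewrite mulrBr.
  rewrite sumrB -mulr_suml D0 mul0r subr0 (bigD1 i)//= eqxx mulr1 big1 ?addr0//.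
  by move=> e /negPf; rewrite eq_sym => ->; rewrite mulr0.
rewrite -big_split /=; apply: eq_bigr => e _.
have -> : (i == e)%:Z - (i == e0)%:Z = (F e).1.2 i - (F e).2 i :> int.
  have [_ _ /(congr1 (fun A : pos => A i))] := FP e.
  by rewrite [LHS]ffunE [X in _ + X = _]ffunE [RHS]ffunE [X in _ = _ + X]ffunE !unit_coordE.
have natE (x : int) (n : nat) : x *+ n = x * n%:Z by rewrite -mulr_natr natz.
have /andP[De1 De2] : - L%:Z <= D e <= L%:Z by rewrite -ler_norml.
rewrite [X in _ = X]ffunE !ffunMnE [X in X *+ L]ffunE !natE !gez0_abs; [|by rewrite subr_ge0|by rewrite -lerBlDl sub0r].
ring.
Qed.

Lemma reachable_ball_uniform (L : nat) : exists r, forall f,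
  (forall v, incident v (f v)) -> exists D0, forall D,
  \sum_e D e = 0 -> (forall e, `|D e| <= L%:Z) -> reachable f r (D0 + D).
Proof.
have /choice[r rP] := fun f => reachable_ball f L.
have /card_gt0P[e0 _] := E_gt0; have [v _] := edge_vertex e0.
exists (\sum_f r f)%N => f fP; have [D0 D0P] := rP f; exists D0 => D sD DL.
apply: (reachable_pad (fP v)) (D0P D sD DL).
by rewrite (bigD1 f)//= leq_addr.
Qed.

End Cone.

(** * Balls of nearly optimal positions *)

Section NearOptimal.
Context (R : realType) (G : simple_graph).
Context (d : G -> edge G) (dP : forall v, incident v (d v)).
Context (k_gt0 : (0 < #|G|)%N).
Local Notation E := (edge G).
Local Notation pos := {ffun E -> int}.
Local Notation u := (@unit_coord G).
Local Notation val := (@val R G d).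
Local Notation play := (@play R G d).
Local Notation run := (foldl (opt_step R d)).
Implicit Types (N D : pos) (v : G) (e : E) (y : nat * pos).

Definition top n : R := sup (range (val n)).

Definition top_limit : R := inf (range top).

Lemma has_sup_val n : has_sup (range (val n)).
Proof.
split; first by exists (val n 0), 0.
by exists 1 => _ [N _ <-]; exact: val_le1.
Qed.

Lemma val_le_top n N : val n N <= top n.
Proof. by apply: (ub_le_sup (has_sup_val n).2); exists N. Qed.

Lemma top_ge0 n : 0 <= top n.
Proof. exact: le_trans (val_ge0 _ _ _ _) (val_le_top n 0). Qed.

(** The value of a position is an average of values with one round less. *)
Lemma top_decr m n : (m <= n)%N -> top n <= top m.
Proof.
move=> /subnK <-; elim: (n - m)%N => // l IH; apply: le_trans IH.
apply: ge_sup; first exact: (has_sup_val _).1.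
move=> _ [N _ <-]; rewrite addSn valS -[leRHS](avg_const _ k_gt0).
by apply: le_avg => v; exact: val_le_top.
Qed.

Lemma has_inf_top : has_inf (range top).
Proof.
split; first by exists (top 0), 0%N.
by exists 0 => _ [n _ <-]; exact: top_ge0.
Qed.

Lemma top_limit_le n : top_limit <= top n.
Proof. by apply: (ge_inf has_inf_top.2); exists n. Qed.

Lemma run_rounds y w : (run y w).1 = (y.1 - size w)%N.
Proof.
elim: w y => [|v w IH] y /=; first by rewrite subn0.
by rewrite IH /=; lia.
Qed.

(** The gap to an upper bound [U] averages over the [#|G|] draws, so it grows
    at most by the factor [#|G|] in one round, whatever the draw. *)
Lemma run_gap n (U : R) y w : top n <= U -> (n + size w <= y.1)%N ->
  U - val (run y w).1 (run y w).2 <= #|G|%:R ^+ size w * (U - val y.1 y.2).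
Proof.
move=> nU; elim: w y => [|v w IH] [t N] /=; first by rewrite expr0 mul1r.
case: t => [|t] nt; first by lia.
have {}nt : (n + size w <= t)%N by lia.
apply: le_trans (IH (opt_step R d (t.+1, N) v) nt) _.
rewrite exprSr -mulrA ler_wpM2l ?exprn_ge0 ?ler0n//.
rewrite valS /avg mulrBr mulVKf ?pnatr_eq0 -?lt0n//.
have -> : #|G|%:R * U = \sum_(z : G) U.
  by rewrite sumr_const -[RHS]mulr_natl.
rewrite -sumrB (bigD1 v)//= lerDl sumr_ge0// => z _.
rewrite subr_ge0 (le_trans (val_le_top _ _))// (le_trans _ nU)//.
by apply: top_decr; lia.
Qed.

Context (Gconn : connected_graph G) (E_gt0 : (0 < #|edge G|)%N).

(** Below a position whose value nearly is the supremum, all positions of the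
    tree of optimal play keep nearly supremal values to any fixed depth.  A
    dense colour in this tree lets a displaced player catch up with it. *)
Lemma near_optimal_ball (L : nat) (a : R) : a < top_limit ->
  exists m N, forall D, \sum_e D e = 0 -> (forall e, `|D e| <= L%:Z) ->
    a <= val m (N + D).
Proof.
(* Half of the distance from [a] to the limit is lost in the tree of optimal
   play, the other half by the follower. *)
move=> aM; pose a0 := (a + top_limit) / 2; pose eta := (top_limit - a) / 2.
have M1 : top_limit <= 1.
  apply: le_trans (top_limit_le 0) _; apply: ge_sup; first exact: (has_sup_val _).1.
  by move=> _ [N _ <-]; exact: val_le1.
have eta0 : 0 < eta by rewrite /eta; lra.
have [r rP] := reachable_ball_uniform Gconn E_gt0 L.
have /choice[H HP] := fun h => follower dP k_gt0 h r eta0.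
have [B BP] := dense_colour (opt_step R d) (opt_map R d) H.
pose T := (B + \sum_(h < B.+1) H h)%N.
have kT : 0 < #|G|%:R ^+ T :> R by rewrite exprn_gt0// ltr0n.
(* A gap of [2 * eps] at the root grows to at most [top_limit - a0] at depth
   [T]. *)
pose eps := (top_limit - a0) / 2 / #|G|%:R ^+ T.
have eps0 : 0 < eps by rewrite /eps divr_gt0// /a0; lra.
have [_ [n _ <-] nM] := inf_adherent eps0 has_inf_top.
have [_ [N _ <-] NM] := sup_adherent eps0 (has_sup_val (n + T).+1).
have {}NM : top (n + T).+1 - eps < val (n + T).+1 N by [].
pose y := ((n + T).+1, N).
have [w [f [h [wB hB fP]]]] := BP y.
have HT : (H h <= \sum_(h < B.+1) H h)%N.
  by rewrite (bigD1 (Ordinal (hB : (h < B.+1)%N)))//= leq_addr.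
have fv v : incident v (f v).
  have [w' [_ <-]] := fP [::] isT; rewrite ffunE.
  exact: play_incident.
have [D0 D0P] := rP f fv.
exists (run y w).1, ((run y w).2 + D0) => D sD DL.
rewrite -addrA; have -> : a = a0 - eta by rewrite /a0 /eta; lra.
apply: (HP h f) (D0P D sD DL) fP _; first by rewrite /a0; lra.
move=> z zH; rewrite -foldl_cat; set w' := w ++ z.
have w'T : (size w' <= T)%N by rewrite size_cat /T; lia.
split; first by rewrite run_rounds /=; lia.
have ny : (n + size w' <= y.1)%N by rewrite /=; lia.
have gap := run_gap (ltW nM) ny.
have : #|G|%:R ^+ size w' * (top_limit + eps - val (n + T).+1 N)
       <= #|G|%:R ^+ T * (2 * eps).
  apply: ler_pM; rewrite ?exprn_ge0 ?ler0n//.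
  - by rewrite subr_ge0 (le_trans (val_le_top _ _))// (le_trans _ (ltW nM))//
      top_decr//; lia.
  - by rewrite ler_weXn2l// ler1n.
  - by have := top_limit_le (n + T).+1; lra.
have -> : #|G|%:R ^+ T * (2 * eps) = top_limit - a0.
  rewrite /eps; field; first by rewrite lt0r_neq0.
move=> /(le_trans gap).
by move: (val (run y w').1 (run y w').2) => V; lra.
Qed.

End NearOptimal.

(** * Steering towards a distant target *)

Lemma sum_multiples (R : numDomainType) (F : nat -> R) (q n : nat) :
  (0 < q)%N -> (forall s, 0 <= F s) ->
  \sum_(0 <= j < n) F (j * q)%N <= \sum_(0 <= s < n * q) F s.
Proof.
move=> q0 F0; rewrite big_nat_mul; apply: ler_sum => j _.
rewrite big_ltn; last by rewrite mulSn; lia.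
by rewrite lerDl sumr_ge0.
Qed.

Lemma sum_constz (T : finType) (x : int) : \sum_(t : T) x = #|T|%:Z * x.
Proof. by rewrite sumr_const -[_ *+ _]mulr_natl natz. Qed.

Section Steering.
Context (R : realType) (G : simple_graph) (Gconn : connected_graph G).
Context (d : G -> edge G) (dP : forall v, incident v (d v)).
Context (k_gt0 : (0 < #|G|)%N) (E_gt0 : (0 < #|edge G|)%N).
Local Notation E := (edge G).
Local Notation pos := {ffun E -> int}.
Local Notation u := (@unit_coord G).
Local Notation val := (@val R G d).
Local Notation degree v := (deg (finset.setT : {set E}) v).
Implicit Types (N D X : pos) (v : G) (e : E).

Lemma degree_gt0 v : (0 < degree v)%N.
Proof. by apply/card_gt0P; exists (d v); rewrite !inE dP. Qed.

(** Choosing uniformly among the incident edges, in units that make all the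
    probabilities integers. *)
Definition weight v e : nat := (incident v e * \prod_(z | z != v) degree z)%N.

Definition weights : nat := (\prod_v degree v)%N.

Definition flow e : nat := (\sum_v weight v e)%N.

Definition period : nat := (#|G| * weights)%N.

Lemma weight_gt0 v e : incident v e -> (0 < weight v e)%N.
Proof. by move=> ve; rewrite /weight ve mul1n prodn_gt0// => z; exact: degree_gt0. Qed.

Lemma sum_weight v : (\sum_e weight v e)%N = weights.
Proof.
rewrite /weight -big_distrl /= /weights [RHS](bigD1 v)//=; congr muln.
by rewrite /deg -sum1_card [RHS]big_mkcond; apply: eq_bigr => e _; rewrite !inE; case: incident.
Qed.

Lemma weights_gt0 : (0 < weights)%N.
Proof. by rewrite prodn_gt0// => v; exact: degree_gt0. Qed.

Lemma period_gt0 : (0 < period)%N.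
Proof. by rewrite muln_gt0 k_gt0 weights_gt0. Qed.

Lemma sum_flow : (\sum_e flow e)%N = period.
Proof.
rewrite exchange_big /= (eq_bigr (fun=> weights)) => [|v _]; last exact: sum_weight.
by rewrite sum_nat_const.
Qed.

Lemma flow_le e : (flow e <= period)%N.
Proof. by rewrite -sum_flow (bigD1 e)//= leq_addr. Qed.

Definition flow_pos : pos := [ffun e => (flow e)%:Z].

Definition greedy D v : E := best d (fun e => D e) v.

(** [D] is [period] times the surplus over a target that moves by the flow in
    [period] rounds. *)
Definition next D v : pos := D - u (greedy D v) *+ period + flow_pos.

Definition loss D : int :=
  \sum_v \sum_e (weight v e)%:Z * (D (greedy D v) - D e).

Definition energy D : int := \sum_e D e ^+ 2.

Lemma loss_term_ge0 D v e : 0 <= (weight v e)%:Z * (D (greedy D v) - D e).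
Proof.
have [ve|/negPf nve] := boolP (incident v e); last by rewrite /weight nve mul0r.
by rewrite mulr_ge0// subr_ge0; exact: (best_max dP (fun e => D e) ve).
Qed.

Lemma loss_ge0 D : 0 <= loss D.
Proof. by do 2![apply: sumr_ge0 => ? _]; exact: loss_term_ge0. Qed.

Lemma nextE D v e :
  next D v e = D e + ((flow e)%:Z - (e == greedy D v)%:Z * period%:Z).
Proof.
rewrite /next ffunE [X in X + _]ffunE [X in _ + X + _]ffunE ffunMnE ffunE.
by rewrite ffunE -mulr_natr natz; ring.
Qed.

Lemma sum_next D v : \sum_e next D v e = \sum_e D e.
Proof.
under eq_bigr do rewrite nextE.
rewrite big_split /= sumrB -mulr_suml.
have -> : \sum_e (e == greedy D v)%:Z = 1 :> int.
  by rewrite (bigD1 (greedy D v))//= eqxx big1 ?addr0// => e /negPf ->.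
rewrite mul1r -sum_flow (big_morph Posz PoszD (erefl (Posz 0))).
by rewrite subrr addr0.
Qed.

(** The loss is the shortfall of the flow against the greedy choice when both
    are paired with the surplus. *)
Lemma sum_surplus_flow D :
  #|G|%:Z * \sum_e D e * (flow e)%:Z - \sum_v (D (greedy D v)) * period%:Z
  = - (#|G|%:Z * loss D).
Proof.
have -> : \sum_e D e * (flow e)%:Z = \sum_v \sum_e (weight v e)%:Z * D e.
  rewrite exchange_big /=; apply: eq_bigr => e _.
  by rewrite -mulr_suml mulrC (big_morph Posz PoszD (erefl (Posz 0))).
have -> : loss D = \sum_v (weights%:Z * D (greedy D v)
                     - \sum_e (weight v e)%:Z * D e).
  apply: eq_bigr => v _; under eq_bigr do rewrite mulrBr.
  rewrite sumrB -mulr_suml; congr (_ * _ - _).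
  by rewrite -(sum_weight v) (big_morph Posz PoszD (erefl (Posz 0))).
rewrite sumrB mulrBr opprB; congr (_ - _).
by rewrite -mulr_suml /period PoszM -mulr_sumr; ring.
Qed.

(** The average drift of the surplus is the flow minus the greedy choice, so the
    linear part of the change of energy is the shortfall computed above; the
    quadratic part is bounded since no coordinate changes by more than
    [period]. *)
Lemma energy_drift D : \sum_v energy (next D v) <=
  #|G|%:Z * (energy D - 2 * loss D + #|E|%:Z * period%:Z ^+ 2).
Proof.
have -> : #|G|%:Z * (energy D - 2 * loss D + #|E|%:Z * period%:Z ^+ 2) =
   \sum_(v : G) (energy D + 2 * (\sum_e D e * (flow e)%:Z
     - D (greedy D v) * period%:Z) + #|E|%:Z * period%:Z ^+ 2).
  rewrite !big_split /= -mulr_sumr sumrB !sum_constz sum_surplus_flow.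
  by ring.
apply: ler_sum => v _.
have -> : energy (next D v) = energy D
   + 2 * (\sum_e D e * (flow e)%:Z - D (greedy D v) * period%:Z)
   + \sum_e ((flow e)%:Z - (e == greedy D v)%:Z * period%:Z) ^+ 2.
  have -> : D (greedy D v) * period%:Z
      = \sum_e D e * ((e == greedy D v)%:Z * period%:Z).
    rewrite (bigD1 (greedy D v))//= eqxx mul1r big1 ?addr0// => e /negPf ->.
    by rewrite mul0r mulr0.
  rewrite -sumrB mulr_sumr -!big_split /=; apply: eq_bigr => e _.
  by rewrite nextE; ring.
rewrite lerD2l -sum_constz; apply: ler_sum => e _.
have := flow_le e; case: eqP => _; rewrite ?mul1r ?mul0r; nia.
Qed.

(** A small loss makes the surplus almost constant on the edges at each vertex,
    hence on all edges; if its sum is [0] it is small everywhere. *)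
Lemma loss_spread : exists K : nat, forall D, \sum_e D e = 0 ->
  forall e, `|D e| <= K%:Z * loss D.
Proof.
have /card_gt0P[e0 _] := E_gt0.
have loss_max D v e : incident v e -> D (greedy D v) - D e <= loss D.
  move=> ve; rewrite /loss (bigD1 v)//= (bigD1 e)//=.
  rewrite -addrA ler_wpDr//.
    rewrite addr_ge0 ?sumr_ge0// => [e' _|v' _]; first exact: loss_term_ge0.
    by rewrite sumr_ge0// => e' _; exact: loss_term_ge0.
  rewrite ler_peMl//; last by rewrite lez_nat weight_gt0.
  by rewrite subr_ge0; exact: (best_max dP (fun e => D e) ve).
have /choice[C CP] : forall e, exists C : nat, forall D,
    `|D e - D e0| <= C%:Z * loss D.
  apply: (edge_connected_ind (e0 := e0) (P := fun e => exists C : nat, forall D,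
    `|D e - D e0| <= C%:Z * loss D)); first exact: Gconn.
    by exists 0%N => D; rewrite subrr normr0 mul0r.
  move=> v e1 e2 ve1 ve2 [C CP]; exists C.+1 => D.
  have := CP D; have := loss_max D v _ ve1; have := loss_max D v _ ve2.
  have := best_max dP (fun e => D e) ve1; have := best_max dP (fun e => D e) ve2.
  rewrite -/(greedy D v) intS mulrDl mul1r; move: (C%:Z * loss D) (loss D).
  move: (D e0) (D e1) (D e2) (D (greedy D v)) => x0 x1 x2 x l l'.
  by lia.
pose K := (\sum_e C e)%N.
have KP D e : `|D e - D e0| <= K%:Z * loss D.
  apply: le_trans (CP e D) _; rewrite ler_wpM2r ?loss_ge0// lez_nat.
  by rewrite /K (bigD1 e)//= leq_addr.
exists (2 * K)%N => D sD.
have D0 : `|D e0| <= K%:Z * loss D.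
  have n0 : 0 < #|E|%:Z by rewrite ltz_nat.
  rewrite -(ler_pM2l n0).
  have -> : #|E|%:Z * `|D e0| = `|\sum_e (D e - D e0)|.
    rewrite sumrB sD sub0r normrN sum_constz normrM.
    by rewrite (ger0_norm (ltW n0)).
  apply: le_trans (ler_norm_sum _ _ _) _.
  rewrite -sum_constz; apply: ler_sum => e _.
  exact: KP.
move=> e; have := KP D e; rewrite PoszM; lia.
Qed.

(** The greedy process is encoded by the iterates of its transition operator;
    all that is used of the expectation is linearity and monotonicity. *)
Fixpoint expect s (g : pos -> R) D : R :=
  if s is s'.+1 then avg (fun v => expect s' g (next D v)) else g D.

Lemma expect_affine s (g : pos -> R) a b D :
  expect s (fun D => a + b * g D) D = a + b * expect s g D.
Proof.
elim: s D => [//|s IH] D /=; rewrite -avgZ -[X in X + _](avg_const a k_gt0) -avgD.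
by congr (_ * _); apply: eq_bigr => v _; rewrite IH.
Qed.

Local Notation rloss := (fun D => (loss D)%:~R : R).
Local Notation bound := (#|E|%:R * period%:R ^+ 2 : R).

Lemma expect_loss_ge0 s D : 0 <= expect s rloss D.
Proof.
elim: s D => [|s IH] D /=; first by rewrite ler0z loss_ge0.
by rewrite /avg mulr_ge0 ?invr_ge0 ?ler0n// sumr_ge0.
Qed.

Lemma expect_loss_sum n D :
  2 * \sum_(0 <= s < n) expect s rloss D <= (energy D)%:~R + n%:R * bound.
Proof.
elim: n D => [|n IH] D.
  rewrite big_geq// mulr0 mul0r addr0 ler0z; apply: sumr_ge0 => e _.
  exact: sqr_ge0.
rewrite big_nat_recl//= mulrDr.
have -> : \sum_(0 <= s < n) avg (fun v => expect s rloss (next D v))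
   = avg (fun v => \sum_(0 <= s < n) expect s rloss (next D v)).
  by rewrite /avg -mulr_sumr exchange_big.
rewrite -avgZ.
apply: le_trans (_ : _ <= 2 * (loss D)%:~R
   + avg (fun v => (energy (next D v))%:~R + n%:R * bound)) _.
  by rewrite lerD2l; apply: le_avg => v; exact: IH.
rewrite avgD avg_const// -[n.+1%:R]natr1 mulrDl mul1r.
suff : avg (fun v => (energy (next D v))%:~R)
   <= (energy D)%:~R - 2 * (loss D)%:~R + bound :> R by lra.
rewrite /avg ler_pdivrMl ?ltr0n// -raddf_sum /=.
have := energy_drift D; rewrite -(ler_int R) => /le_trans; apply.
by rewrite !(rmorphM, rmorphD, rmorphN, rmorphXn) /= -!pmulrn.
Qed.

(** The energy is nonnegative and loses twice the loss per step on average, so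
    the time average of the expected loss is bounded.  Were the loss large at
    all late multiples of the period, the multiples between [p] and [2 * p]
    alone would violate this bound. *)
Lemma expect_loss_bounded J : exists2 j, (J <= j)%N &
  expect (j * period) rloss 0 <= period%:R * bound.
Proof.
apply/not_exists2P => /= no.
pose p := J.+1.
have big j : (p <= j)%N -> period%:R * bound < expect (j * period) rloss 0.
  move=> pj; rewrite ltNge; apply/negP => le; have [] := no j => // .
  by apply; rewrite ltnW.
have := expect_loss_sum (2 * p * period) 0.
have -> : energy 0 = 0 by rewrite /energy big1// => e _; rewrite ffunE expr0n.
have := sum_multiples (2 * p) period_gt0 (fun s => expect_loss_ge0 s 0).
rewrite (big_cat_nat (n := p))//=; last by lia.
have : 0 <= \sum_(0 <= j < p) expect (j * period) rloss 0.
  by rewrite sumr_ge0// => j _; exact: expect_loss_ge0.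
have : p%:R * (period%:R * bound)
    < \sum_(p <= j < 2 * p) expect (j * period) rloss 0.
  have -> : p%:R * (period%:R * bound) = \sum_(p <= j < 2 * p) period%:R * bound.
    by rewrite sumr_const_nat -[RHS]mulr_natl mul2n -addnn addnK.
  apply: ltr_sum_nat; first by lia.
  by move=> j /andP[pj _]; exact: big.
rewrite !natrM; set b := bound; lra.
Qed.

(** A player who regards the target as moving by the flow realizes the greedy
    process: after the last round the surplus is the displacement from [N0]. *)
Lemma expect_le_val m N0 (g : pos -> R) :
  (forall X, \sum_e X e = 0 -> g (X *+ period) <= val m (N0 + X)) ->
  forall s N D, \sum_e D e = 0 ->
    N *+ period = N0 *+ period + flow_pos *+ s + D ->
    expect s g D <= val (s + m) N.
Proof.
move=> gP; elim=> [|s IH] N D sD ND /=.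
  have DE : D = (N - N0) *+ period.
    by rewrite mulrnBl ND mulr0n addr0 addrC addKr.
  have := gP (N - N0); rewrite -DE [N0 + _]addrC subrK; apply.
  move: sD; rewrite DE.
  under eq_bigr do rewrite ffunMnE.
  rewrite sumrMnl => /eqP; rewrite mulrn_eq0 => /orP[|/eqP//].
  by rewrite eqn0Ngt period_gt0.
rewrite -/(addn s m).
apply: le_trans (val_ge_choice R dP (s + m) N (pi := greedy D) _); last first.
  by move=> v; exact: best_incident.
apply: le_avg => v; apply: IH; first by rewrite sum_next.
by rewrite mulrnBl ND mulrSr /next -!addrA; congr (_ + (_ + _)); rewrite addrC addrA.
Qed.

(** A bounded expected loss keeps the final displacement bounded with
    probability close to [1], by Markov's inequality and [loss_spread].  The
    radius [L] is chosen before the target and the starting time, which is what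
    allows the target to be taken from [near_optimal_ball]. *)
Lemma steering (theta : R) : 0 < theta -> exists L : nat, forall m N0 (a : R),
  0 <= a ->
  (forall X, \sum_e X e = 0 -> (forall e, `|X e| <= L%:Z) ->
     a <= val m (N0 + X)) ->
  forall J, exists2 j, (J <= j)%N &
    a * (1 - theta) <= val (j * period + m) (N0 + flow_pos *+ j).
Proof.
move=> theta0; have [K KP] := loss_spread.
pose Lam : R := (period%:R * bound) / theta + 1.
have b0 : 0 <= period%:R * bound :> R.
  by rewrite !mulr_ge0 ?ler0n// exprn_ge0 ?ler0n.
have Lam0 : 0 < Lam by rewrite ltr_wpDl// divr_ge0// ltW.
exists (K * Num.truncn Lam)%N => m N0 a a0 aP J.
have [j Jj jP] := expect_loss_bounded J; exists j => //.
(* Markov's inequality: [g] is at most [a] everywhere and at most [0] where the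
   loss exceeds [Lam]. *)
pose g D := a + (- a / Lam) * (loss D)%:~R.
apply: le_trans (_ : expect (j * period) g 0 <= _).
  rewrite expect_affine mulrBr mulr1 lerD2l mulNr mulNr lerN2.
  rewrite -mulrA ler_wpM2l// mulrC ler_pdivrMr//.
  apply: le_trans jP _.
  by rewrite /Lam mulrDr mulr1 [theta * _]mulrC divfK ?gt_eqF// lerDl ltW.
apply: (@expect_le_val m N0) => //; last first.
- by rewrite addr0 mulrnDl [_ *+ (j * _)]mulrnA.
- by rewrite big1// => e _; rewrite ffunE.
move=> X sX; have sXq : \sum_e (X *+ period) e = 0.
  by under eq_bigr do rewrite ffunMnE; rewrite sumrMnl sX mul0rn.
have [lo|hi] := leP (loss (X *+ period))%:~R Lam.
  apply: le_trans (_ : a <= _).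
    rewrite /g gerDl mulNr mulNr oppr_le0.
    by rewrite mulr_ge0 ?ler0z ?loss_ge0// divr_ge0// ltW.
  apply: aP => // e; have := KP _ sXq e.
  rewrite ffunMnE normrMn => XK.
  have lT : loss (X *+ period) <= (Num.truncn Lam)%:Z.
    move: lo; have := loss_ge0 (X *+ period).
    case: (loss _) => // l _; rewrite -pmulrn lez_nat => lo.
    by rewrite truncn_ge_nat ?(ltW Lam0).
  apply: le_trans (_ : `|X e| *+ period <= _).
    by rewrite -mulr_natr ler_peMr// natz lez_nat period_gt0.
  by apply: le_trans XK _; rewrite PoszM ler_wpM2l.
apply: le_trans (val_ge0 _ _ _ _).
rewrite /g -[X in X + _]mulr1 mulNr mulNr -mulrA -mulrBr mulr_ge0_le0//.
by rewrite subr_le0 mulrC ler_pdivlMr// mul1r ltW.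
Qed.

End Steering.

(** * The flow direction is interior *)

Section FlowDirection.
Context (R : realType) (G : simple_graph) (Gconn : connected_graph G).
Context (d : G -> edge G) (dP : forall v, incident v (d v)).
Context (k_gt0 : (0 < #|G|)%N).
Local Notation E := (edge G).
Local Notation degree v := (deg (finset.setT : {set E}) v).
Implicit Types (v : G) (e : E) (F : {set E}).

Lemma weights_le_full F v : deg F v = degree v ->
  (weights G <= \sum_(e in F) weight v e)%N.
Proof.
move=> dF; rewrite -(sum_weight v).
rewrite (bigID (fun e => e \in F)) /= [X in (_ + X)%N]big1 ?addn0// => e eF.
have /eqP sub : ([set e in F | incident v e] == [set e in finset.setT | incident v e])%SET.
  rewrite eqEcard; apply/andP; split; last by move: dF; rewrite /deg => ->.
  by apply/fintype.subsetP => x; rewrite !inE => /andP[].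
apply/eqP; rewrite /weight muln_eq0 eqb0; apply/orP; left; apply/negP => ve.
have : e \in [set e in finset.setT | incident v e]%SET by rewrite !inE.
by rewrite -sub !inE (negPf eF).
Qed.

(** A vertex incident with an edge in [F] and an edge outside [F] contributes
    to the flow through [F] and is not counted as full. *)
Lemma full_deg_count_lt_flow F :
  finset.set0 \proper F -> F \proper finset.setT ->
  (weights G * full_deg_count F < \sum_(e in F) flow e)%N.
Proof.
move=> /properP[_ [e0 e0F _]] /properP[_ [e1 _ e1F]].
have [v [e [e' [ve ve' eF e'F]]]] : exists v e e',
    [/\ incident v e, incident v e', e \in F & e' \notin F].
  apply: contrapT => no; apply: (negP e1F).
  apply: (edge_connected_ind (e0 := e0) (P := fun e => e \in F)) => //.
  move=> v e e' ve ve' eF; apply: contrapT => /negP e'F.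
  by apply: no; exists v, e, e'.
rewrite exchange_big /= /full_deg_count -sum1_card big_distrr /= muln1.
rewrite [X in (X < _)%N]big_mkcond /= (bigD1 v)//= [X in (_ < X)%N](bigD1 v)//=.
rewrite -addSn leq_add//; last first.
  by apply: leq_sum => z _; rewrite inE; case: eqP => // /weights_le_full.
rewrite inE; case: eqP => [|_]; last first.
  by rewrite (bigD1 e)//= ltn_addr// (weight_gt0 dP).
move=> dF; have := weights_le_full dF.
rewrite -[X in (X <= _)%N -> _](sum_weight v).
rewrite [X in (X <= _)%N -> _](bigID (fun e => e \in F)) /=.
rewrite -[X in (_ <= X)%N -> _]addn0 leq_add2l leqn0 => /eqP.
by rewrite (bigD1 e')//= => /eqP; rewrite addn_eq0 -leqn0 leqNgt (weight_gt0 dP).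
Qed.

Definition flow_direction : {ptws E -> R} :=
  fun e => (flow e)%:R / (period G)%:R.

Lemma flow_direction_region : region flow_direction.
Proof.
have p0 : 0 < (period G)%:R :> R by rewrite ltr0n (period_gt0 dP).
have W0 : 0 < (weights G)%:R :> R by rewrite ltr0n (weights_gt0 dP).
split; first split.
- by move=> e; rewrite divr_ge0.
- by rewrite -mulr_suml -natr_sum sum_flow divff// gt_eqF.
move=> F F0 FT; rewrite -mulr_suml -natr_sum ltr_pdivlMr//.
rewrite /period natrM mulrAC mulrA mulVf ?mul1r ?pnatr_eq0 -?lt0n//.
by rewrite -natrM ltr_nat full_deg_count_lt_flow.
Qed.

(** Starting positions at distance [O(1)] from the flow direction that hit, for
    [n = j * period + m], the far starts of the steering towards [N0]. *)
Definition flow_start (e0 : E) (N0 : {ffun E -> nat}) m n : {ffun E -> nat} :=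
  [ffun e => if (n < m)%N then ((e == e0) * n)%N else
     (N0 e + (n - m) %/ period G * flow e + (e == e0) * ((n - m) %% period G))%N].

Lemma sum_eq_mul (e0 : E) n : (\sum_e (e == e0) * n = n)%N.
Proof.
rewrite (bigD1 e0)//= eqxx mul1n big1 ?addn0// => e /negPf ->.
by rewrite mul0n.
Qed.

Lemma rounds_flow_start e0 N0 m n : rounds N0 = m ->
  rounds (flow_start e0 N0 m n) = n.
Proof.
move=> N0m; rewrite /rounds /flow_start.
under eq_bigr do rewrite ffunE.
have [nm|mn] := ltnP n m; first exact: sum_eq_mul.
rewrite !big_split /= sum_eq_mul -big_distrr /= sum_flow.
by rewrite -/(rounds N0) N0m -addnA -divn_eq subnKC.
Qed.

Lemma flow_start_multiple e0 N0 m j : flow_start e0 N0 m (j * period G + m) =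
  [ffun e => (N0 e + j * flow e)%N].
Proof.
apply/ffunP => e; rewrite !ffunE ltnNge leq_addl /= addnK.
by rewrite mulnK ?(period_gt0 dP)// modnMl muln0 addn0.
Qed.

(** The flow part is exactly proportional to the flow direction; the rest of the
    position and the rounds that it takes are bounded. *)
Lemma flow_start_close e0 N0 m n e : rounds N0 = m ->
  `|(flow_start e0 N0 m n e)%:R - n%:R * flow_direction e|
    <= 2 * (m + period G)%:R.
Proof.
move=> N0m; have p0 : 0 < (period G)%:R :> R by rewrite ltr0n (period_gt0 dP).
have fd0 : 0 <= flow_direction e by rewrite divr_ge0.
have fd1 : flow_direction e <= 1.
  by rewrite ler_pdivrMr// mul1r ler_nat flow_le.
rewrite ffunE; have [nm|mn] := ltnP n m.
  have n0 : 0 <= n%:R :> R by [].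
  have nmR : n%:R <= m%:R :> R by rewrite ler_nat ltnW.
  rewrite natrM natrD; case: (e == e0);
    rewrite ?mul1r ?mul0r ler_norml; apply/andP; split; nra.
set j := ((n - m) %/ _)%N; set r := ((n - m) %% _)%N.
have nE : n = (m + (j * period G + r))%N by rewrite -divn_eq subnKC.
have N0e : (N0 e)%:R <= m%:R :> R by rewrite ler_nat -N0m /rounds (bigD1 e)//= leq_addr.
have rp : r%:R <= (period G)%:R :> R by rewrite ler_nat ltnW// ltn_mod (period_gt0 dP).
have fE : (flow e)%:R = (period G)%:R * flow_direction e.
  by rewrite /flow_direction mulrC divfK// gt_eqF.
have N0e0 : 0 <= (N0 e)%:R :> R by [].
have r0 : 0 <= r%:R :> R by [].
have m0 : 0 <= m%:R :> R by [].
have -> : (N0 e + j * flow e + (e == e0) * r)%:R - n%:R * flow_direction e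
    = (N0 e)%:R + (e == e0)%:R * r%:R - (m%:R + r%:R) * flow_direction e.
  move: j r nE {rp r0} => j r ->; rewrite !natrD.
  by rewrite (natrM _ j (flow e)) (natrM _ j (period G)) natrM fE; ring.
rewrite natrD; move: (flow_direction e) fd0 fd1 => x x0 x1.
by case: (e == e0); rewrite ?mul1r ?mul0r ler_norml; apply/andP; split; nra.
Qed.

End FlowDirection.

(** * Conclusion *)

Section Conclusion.
Context (R : realType) (G : simple_graph) (Gconn : connected_graph G).
Context (d : G -> edge G) (dP : forall v, incident v (d v)).
Context (k_gt0 : (0 < #|G|)%N) (E_gt0 : (0 < #|edge G|)%N).
Context (c : R) (c_spec : is_cG G c).

(** Along the flow from the centre of a near-optimal ball the values converge to
    [c], but infinitely many of them are at least [a * (1 - theta)]. *)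
Lemma below_top_limit (a theta : R) :
  0 < a -> a < top_limit R d -> 0 < theta -> a * (1 - theta) <= c.
Proof.
move=> a0 aM theta0; have /card_gt0P[e0 _] := E_gt0.
have [L LP] := steering Gconn dP k_gt0 E_gt0 theta0.
have [m [N0 N0P]] := near_optimal_ball dP k_gt0 Gconn E_gt0 L aM.
have N0pos : 0 < val R d m N0.
  apply: lt_le_trans a0 _; rewrite -[N0]addr0; apply: N0P.
    by rewrite big1// => e _; rewrite ffunE.
  by move=> e; rewrite ffunE normr0.
pose N0n : {ffun edge G -> nat} := [ffun e => absz (N0 e)].
have N0nE e : (N0n e)%:Z = N0 e.
  by rewrite ffunE gez0_abs// (val_gt0_ge0 k_gt0 e N0pos).
have N0m : rounds N0n = m.
  apply/eqP; rewrite -eqz_nat /rounds (big_morph Posz PoszD (erefl (Posz 0))).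
  by rewrite (eq_bigr N0) ?(val_gt0_sum k_gt0 N0pos).
have cv : ((fun n => pG R (flow_start e0 N0n m n)) @ \oo --> c)%classic.
  apply: (c_spec.2 _ _ (flow_direction_region R Gconn dP k_gt0) _ _).
    by move=> n; exact: rounds_flow_start.
  by exists (2 * (m + period G)%:R) => n e; exact: (flow_start_close R dP).
rewrite leNgt; apply/negP => clt.
have [J _ JP] := cvgr_lt c cv _ clt.
have [j Jj] := LP m N0 a (ltW a0) N0P J.
rewrite leNgt => /negP; apply.
have := JP (j * period G + m)%N; rewrite /= (pG_val R dP k_gt0).
rewrite rounds_flow_start// (flow_start_multiple dP k_gt0).
have -> : [ffun e => ([ffun e => (N0n e + j * flow e)%N] e)%:Z]
    = N0 + flow_pos G *+ j.
  apply/ffunP => e; rewrite !ffunE [in RHS]ffunMnE ffunE.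
  by rewrite PoszD PoszM -N0nE ffunE -mulr_natl natz.
apply; apply: leq_trans Jj _; apply: leq_trans (leq_addr _ _).
by rewrite leq_pmulr// (period_gt0 dP).
Qed.

Lemma top_limit_le_c : top_limit R d <= c.
Proof.
(* The choice of [theta] makes [a * (1 - theta)] the midpoint of [c] and [a]. *)
have c0 := c_spec.1; rewrite leNgt; apply/negP => cM.
pose a := (c + top_limit R d) / 2.
have a0 : 0 < a by rewrite /a; lra.
pose theta := (top_limit R d - c) / (4 * a).
have theta0 : 0 < theta by apply: divr_gt0; lra.
have aM : a < top_limit R d by rewrite /a; lra.
have := below_top_limit a0 aM theta0.
have -> : a * (1 - theta) = a - (top_limit R d - c) / 4.
  by rewrite /theta; field; rewrite gt_eqF.
by rewrite /a; lra.
Qed.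

End Conclusion.

Lemma Mbar_le_top (R : realType) (G : simple_graph) (d : G -> edge G)
    (dP : forall v, incident v (d v)) (k_gt0 : (0 < #|G|)%N) delta n :
  (Mbar G delta n <= (top R d n)%:E)%E.
Proof.
apply: ge_ereal_sup => _ [N [[_ N1] _] <-]; rewrite lee_fin.
suff <- : rounds N = n by rewrite (pG_val R dP k_gt0); exact: val_le_top.
move: N1; rewrite /scaled -mulr_suml -natr_sum -/(rounds N).
have [->|n0] := posnP n.
  by rewrite invr0 mulr0 => /eqP; rewrite eq_sym oner_eq0.
move=> /(congr1 (fun x => x * n%:R)); rewrite mul1r divfK ?pnatr_eq0 -?lt0n//.
by move=> /eqP; rewrite eqr_nat => /eqP.
Qed.

Theorem theorem2 (R : realType) (G : simple_graph)
    (G_connected : connected_graph G)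
    (G_edges : (2 <= #|edge G|)%N)
    (c : R) (c_spec : is_cG G c)
    (delta : R) (delta_gt0 : (0 < delta)%R) :
  (limn_esup (Mbar G delta) <= c%:E)%E.
Proof.
have E_gt0 : (0 < #|edge G|)%N by exact: ltnW.
have /card_gt0P[e0 _] := E_gt0; have [v0 _] := edge_vertex e0.
have k_gt0 : (0 < #|G|)%N by apply/card_gt0P; exists v0.
have /choice[d dP] := fun v : G => incident_edge v G_connected E_gt0.
rewrite limn_esup_lim; apply/lee_addgt0Pr => eps eps0.
apply: lime_le; first exact: is_cvg_esups.
have [_ [n0 _ <-] n0P] := inf_adherent eps0 (has_inf_top R d k_gt0).
exists n0 => // n /= nn0; apply: ge_ereal_sup => _ [l /= nl <-].
apply: le_trans (Mbar_le_top dP k_gt0 delta l) _.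
rewrite -EFinD lee_fin (le_trans (top_decr R d k_gt0 (leq_trans nn0 nl)))//.
apply: le_trans (ltW n0P) _.
by rewrite lerD2r; exact: (top_limit_le_c G_connected dP k_gt0 E_gt0 c_spec).
Qed.
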